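(* Let $D$ be the classical second order derivative operator on a uniform grid with spacing $h>0$, either periodic or with the boundary closures given in the context, and let $A$ be the corresponding averaging operator given in the context. Then for all scalar-valued grid functions $\mathbf{u},\mathbf{v}$ the product rule $$D(\mathbf{u}\mathbf{v}) = (A\mathbf{u})(D\mathbf{v}) + (D\mathbf{u})(A\mathbf{v})$$ holds. Moreover, $A$ is of the same order of accuracy as $D$, i.e. for a smooth function $u$ with grid values $\mathbf{u}_i=u(x_i)$ one has, as $h\to 0$, $(A\mathbf{u})_i = u(x_i)+\mathcal{O}(h^2)$ at interior nodes (all nodes in the periodic case) and, in the non-periodic case, $(A\mathbf{u})_{i} = u(x_{i})+\mathcal{O}(h)$ at the boundary nodes $i\in\{0,N\}$.
   Context: A grid function is a family $\mathbf{u}=(\mathbf{u}_i)_i$ of values at the nodes $x_i$. Products are taken pointwise: $(\mathbf{u}\mathbf{v})_i=\mathbf{u}_i\mathbf{v}_i$. The grid is uniform, $x_{i+1}-x_i=h$. Periodic case: indices are taken modulo the number of nodes (and smooth functions $u$ are periodic), and for every $i$ $$(D\mathbf{u})_i=\frac{\mathbf{u}_{i+1}-\mathbf{u}_{i-1}}{2h},\qquad (A\mathbf{u})_i=\frac{\mathbf{u}_{i+1}+\mathbf{u}_{i-1}}{2}.$$ Non-periodic case (summation-by-parts operator) with nodes $x_0,\dots,x_N$: the same formulas are used at the interior nodes $1\le i\le N-1$, together with the boundary closures $$(D\mathbf{u})_0=\frac{\mathbf{u}_1-\mathbf{u}_0}{h},\quad (D\mathbf{u})_N=\frac{\mathbf{u}_N-\mathbf{u}_{N-1}}{h},\quad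 (A\mathbf{u})_0=\frac{\mathbf{u}_1+\mathbf{u}_0}{2},\quad (A\mathbf{u})_N=\frac{\mathbf{u}_N+\mathbf{u}_{N-1}}{2}.$$ *)

(* Defs.v *)
From HB Require Import structures.
From mathcomp Require Import all_boot all_order all_algebra.
From mathcomp Require Import all_classical all_reals all_analysis.

Set Implicit Arguments.
Unset Strict Implicit.
Unset Printing Implicit Defensive.

Import Order.TTheory GRing.Theory Num.Theory.
Import numFieldNormedType.Exports.

Local Open Scope classical_set_scope.
Local Open Scope ring_scope.

Section Operators.
Variable R : realType.

(* ordS and ord_pred are the cyclic successor and predecessor on 'I_n. *)
Definition periodic_D (n : nat) (h : R) (u : 'I_n -> R) : 'I_n -> R :=
  fun i => (u (ordS i) - u (ord_pred i)) / (2 * h).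

Definition periodic_A (n : nat) (u : 'I_n -> R) : 'I_n -> R :=
  fun i => (u (ordS i) + u (ord_pred i)) / 2.

(* Grid functions on the N + 1 nodes x_0, ..., x_N; only meaningful for
   0 < N, since inord is arbitrary outside its range. *)
Definition sbp_D (N : nat) (h : R) (u : 'I_N.+1 -> R) : 'I_N.+1 -> R :=
  fun i =>
    if i == ord0 then (u (inord 1) - u ord0) / h
    else if i == ord_max then (u ord_max - u (inord N.-1)) / h
    else (u (inord i.+1) - u (inord i.-1)) / (2 * h).

Definition sbp_A (N : nat) (u : 'I_N.+1 -> R) : 'I_N.+1 -> R :=
  fun i =>
    if i == ord0 then (u (inord 1) + u ord0) / 2
    else if i == ord_max then (u ord_max + u (inord N.-1)) / 2
    else (u (inord i.+1) + u (inord i.-1)) / 2.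

Definition uniform_grid (n : nat) (h : R) (x : 'I_n -> R) : Prop :=
  forall i j : 'I_n, j = i.+1 :> nat -> x j - x i = h.

Definition smooth (u : R -> R) : Prop :=
  forall (k : nat) (x : R), derivable (derive1n k u) x 1.

(* C^oo on the closed interval [a, b]: u is smooth on ]a, b[ and every
   derivative extends continuously to [a, b]; d k is the extension of the
   k-th derivative. Nothing is required of u outside [a, b]. *)
Definition smooth_on (a b : R) (u : R -> R) : Prop :=
  exists d : nat -> R -> R,
    {in `[a, b], d 0%N =1 u} /\
    forall k : nat, derivable_oo_LRcontinuous (d k) a b /\
                    {in `]a, b[, derive1 (d k) =1 d k.+1}.

End Operators.

(* Main.v *)
Require Import Defs.
From HB Require Import structures.
From mathcomp Require Import all_boot all_order all_algebra.
From mathcomp Require Import all_classical all_reals all_analysis.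
From mathcomp Require Import ring lra.
Import Order.TTheory GRing.Theory Num.Theory.
Import numFieldNormedType.Exports.
Local Open Scope classical_set_scope.
Local Open Scope ring_scope.

Set Implicit Arguments.
Unset Strict Implicit.

(** The product rule is pointwise algebra: at every node [D] and [A] are the
    difference quotient and the mean of the same two values of the grid
    function, and [pv - qw = ((p + q) (v - w) + (p - q) (v + w)) / 2].

    For the accuracy of [A], two applications of the mean value theorem give
    [u (y + h) + u (y - h) - 2 u y = h (u' c - u' e)] with [c] and [e] at
    distance at most [2 h], so that the midpoint error is at most [h ^+ 2]
    times a Lipschitz constant of [u'] ([midpoint_error]).  At a boundary node
    the error is half the difference of [u] between two neighbouring nodes,
    hence at most [h] times a Lipschitz constant of [u].  Both Lipschitz
    constants exist because the next derivative is continuous on a compact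
    interval ([bounded_derivative_lipschitz]).

    In the periodic case [u] takes the values [u (x i + h)] and [u (x i - h)]
    at the two neighbours of [x i], also across the ends of the grid, because
    [n * h] is one period ([periodic_grid_neighbours]).  A translation by a
    multiple of the period [L] brings [x i] between [0] and [L], and [h <= L],
    so that bounds on the compact interval from [- L] to [L + L] suffice. *)

(** * Product rule *)

Lemma mean_diff_product (R : realType) (h p q v w : R) : h != 0 ->
  (p * v - q * w) / h =
  (p + q) / 2 * ((v - w) / h) + (p - q) / h * ((v + w) / 2).
Proof. by move=> h0; field. Qed.

Lemma periodic_product_rule (R : realType) (n : nat) (h : R) (u v : 'I_n -> R) :
  h != 0 ->
  periodic_D h (u \* v) =1
    (periodic_A u \* periodic_D h v) \+ (periodic_D h u \* periodic_A v).
Proof.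
move=> h0 i; rewrite /periodic_D /periodic_A /=.
by apply: mean_diff_product; rewrite mulf_neq0// pnatr_eq0.
Qed.

(** Every node falls under one of the three formulas of [sbp_D] and [sbp_A],
    including when [N = 0], so no lower bound on [N] is needed. *)
Lemma sbp_product_rule (R : realType) (N : nat) (h : R) (u v : 'I_N.+1 -> R) :
  h != 0 ->
  sbp_D h (u \* v) =1 (sbp_A u \* sbp_D h v) \+ (sbp_D h u \* sbp_A v).
Proof.
move=> h0 i; rewrite /sbp_D /sbp_A /=.
case: ifP => _; first exact: mean_diff_product.
case: ifP => _; first exact: mean_diff_product.
by apply: mean_diff_product; rewrite mulf_neq0// pnatr_eq0.
Qed.

(** * Lipschitz and midpoint estimates *)

Lemma MVT_derivable_oo (R : realType) (a b : R) (f : R -> R) (x y : R) :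
  derivable_oo_LRcontinuous f a b -> a <= x -> x < y -> y <= b ->
  exists2 c, c \in `]x, y[ & f y - f x = derive1 f c * (y - x).
Proof.
move=> fab ax xy yb; apply: MVT => //.
- move=> z; rewrite in_itv/= => /andP[xz zy].
  rewrite derive1E; apply: derivableP; case: fab => + _ _; apply.
  by rewrite in_itv/= (le_lt_trans ax xz) (lt_le_trans zy yb).
- apply: continuous_subspaceW (derivable_oo_LRcontinuous_within fab).
  move=> z /=; rewrite !in_itv/= => /andP[xz zy].
  by rewrite (le_trans ax xz) (le_trans zy yb).
Qed.

Lemma bounded_derivative_lipschitz (R : realType) (a b : R) (f g : R -> R) :
  derivable_oo_LRcontinuous f a b -> {in `]a, b[, derive1 f =1 g} ->
  {within `[a, b], continuous g} ->
  exists2 M, 0 <= M &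
    forall x y, x \in `[a, b] -> y \in `[a, b] ->
      `|f x - f y| <= M * `|x - y|.
Proof.
move=> fab fg cg.
have [M [_ gM]] := compact_bounded
  (continuous_compact cg (@segment_compact R a b)).
(* [compact_bounded] only gives the bounds strictly above [M]. *)
set K := `|M| + 1.
have K0 : 0 <= K by rewrite addr_ge0.
have gK z : z \in `[a, b] -> `|g z| <= K.
  move=> zab; apply: (gM K); last by exists z.
  by rewrite (le_lt_trans (ler_norm M))// ltrDl.
have lip x y : x < y -> x \in `[a, b] -> y \in `[a, b] ->
    `|f y - f x| <= K * `|y - x|.
  rewrite !in_itv/= => xy /andP[ax _] /andP[_ yb].
  have [c /[!in_itv]/= /andP[xc cy] ->] := MVT_derivable_oo fab ax xy yb.
  have ac : a < c by exact: le_lt_trans xc.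
  have cb : c < b by exact: lt_le_trans yb.
  rewrite normrM ler_wpM2r// fg ?in_itv/= ?ac ?cb//.
  by apply: gK; rewrite in_itv/= !ltW.
exists K => // x y xab yab; have [xy|yx|<-] := ltgtP x y.
- by rewrite distrC (distrC x) lip.
- exact: lip.
- by rewrite !subrr normr0 mulr0.
Qed.

Lemma midpoint_error (R : realType) (a b M h y : R) (f g : R -> R) :
  derivable_oo_LRcontinuous f a b -> {in `]a, b[, derive1 f =1 g} -> 0 <= M ->
  (forall s t, s \in `[a, b] -> t \in `[a, b] ->
     `|g s - g t| <= M * `|s - t|) ->
  0 < h -> a <= y - h -> y + h <= b ->
  `|(f (y + h) + f (y - h)) / 2 - f y| <= M * h ^+ 2.
Proof.
move=> fab fg M0 gM h0 ayh yhb.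
have ay : a <= y by lra.
have yb : y <= b by lra.
have yyh : y < y + h by lra.
have yhy : y - h < y by lra.
have [c] := MVT_derivable_oo fab ay yyh yhb.
rewrite in_itv/= => /andP[yc cyh] Ec.
have [e] := MVT_derivable_oo fab ayh yhy yb.
rewrite in_itv/= => /andP[yhe ey] Ee.
rewrite fg ?in_itv/= in Ec; last by apply/andP; split; lra.
rewrite fg ?in_itv/= in Ee; last by apply/andP; split; lra.
have -> : (f (y + h) + f (y - h)) / 2 - f y = h / 2 * (g c - g e).
  by lra.
rewrite normrM ger0_norm; last by lra.
have gce : `|g c - g e| <= M * (2 * h).
  have cab : c \in `[a, b] by rewrite in_itv/=; apply/andP; split; lra.
  have eab : e \in `[a, b] by rewrite in_itv/=; apply/andP; split; lra.
  apply: le_trans (gM c e cab eab) _.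
  by rewrite ler_wpM2l// ger0_norm; lra.
have -> : M * h ^+ 2 = h / 2 * (M * (2 * h)) by field.
by rewrite ler_wpM2l// divr_ge0// ltW.
Qed.

Lemma smooth_on_lipschitz (R : realType) (a b : R) (u : R -> R) :
  smooth_on a b u ->
  exists2 M, 0 <= M &
    forall x y, x \in `[a, b] -> y \in `[a, b] ->
      `|u x - u y| <= M * `|x - y|.
Proof.
move=> [d [d0 dk]]; have [d0ab d01] := dk 0%N; have [d1ab _] := dk 1%N.
have [M M0 dM] := bounded_derivative_lipschitz d0ab d01
  (derivable_oo_LRcontinuous_within d1ab).
by exists M => // x y xab yab; rewrite -!d0// dM.
Qed.

Lemma smooth_on_midpoint (R : realType) (a b : R) (u : R -> R) :
  smooth_on a b u ->
  exists2 M, 0 <= M &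
    forall h y, 0 < h -> a <= y - h -> y + h <= b ->
      `|(u (y + h) + u (y - h)) / 2 - u y| <= M * h ^+ 2.
Proof.
move=> [d [d0 dk]]; have [d0ab d01] := dk 0%N.
have [d1ab d12] := dk 1%N; have [d2ab _] := dk 2%N.
have [M M0 dM] := bounded_derivative_lipschitz d1ab d12
  (derivable_oo_LRcontinuous_within d2ab).
exists M => // h y h0 ayh yhb.
rewrite -!d0 ?in_itv/=; try by apply/andP; split; lra.
exact: midpoint_error d01 M0 dM h0 ayh yhb.
Qed.

Lemma smooth_smooth_on (R : realType) (a b : R) (u : R -> R) :
  smooth u -> smooth_on a b u.
Proof.
move=> su; exists (fun k => derive1n k u); split => // k; split => //.
have cu x : {for x, continuous (derive1n k u)}.
  exact/differentiable_continuous/derivable1_diffP/su.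
split; first by move=> x _; exact: su.
- by apply: cvg_at_right_filter; exact: cu.
- by apply: cvg_at_left_filter; exact: cu.
Qed.

(** * Periodic functions on a periodic grid *)

Lemma periodicz (U V : zmodType) (f : U -> V) (T : U) :
  periodic f T -> forall (z : int) a, f (a + T *~ z) = f a.
Proof.
move=> fT [] n a; first by rewrite -pmulrn periodicn.
by rewrite NegzE mulrNz -pmulrn -(periodicn fT n.+1) subrK.
Qed.

Lemma period_representative (R : realType) (L y : R) : 0 < L ->
  exists z : int, 0 <= y + L *~ z <= L.
Proof.
move=> L0; exists (- Num.floor (y / L)).
have /andP[] := floor_itv (y / L).
rewrite intrD ler_pdivlMr// ltr_pdivrMr// mulrNz -mulrzl => fl fu.
by apply/andP; split; lra.
Qed.

Lemma uniform_gridE (R : realType) (n : nat) (h : R) (x : 'I_n -> R)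
    (i0 i : 'I_n) :
  uniform_grid h x -> i0 = 0%N :> nat -> x i = x i0 + i%:R * h.
Proof.
move=> xh i00; case: i => k; elim: k => [|k IH] kn /=.
  by rewrite mul0r addr0; congr x; exact: val_inj.
have kn' : (k < n)%N by exact: ltnW.
have := xh (Ordinal kn') (Ordinal kn) erefl; rewrite (IH kn')/= -natr1.
by lra.
Qed.

(** The second alternative is the wrap-around from the last node to the first
    one. *)
Lemma uniform_grid_ordS (R : realType) (n : nat) (h : R) (x : 'I_n -> R)
    (i : 'I_n) :
  uniform_grid h x ->
  x (ordS i) = x i + h \/ x (ordS i) = x i + h - n%:R * h.
Proof.
move=> xh; have := ltn_ord i; rewrite leq_eqVlt => /predU1P[iN|iN].
  have S0 : ordS i = 0%N :> nat by rewrite /= iN modnn.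
  have -> : n%:R = i%:R + 1 :> R by rewrite natr1 iN.
  by right; rewrite (uniform_gridE i xh S0); ring.
left; have := xh i (ordS i); rewrite /= modn_small// => /(_ erefl) <-.
by rewrite addrC subrK.
Qed.

Lemma periodic_grid_neighbours (R : realType) (n : nat) (h L : R) (u : R -> R)
    (x : 'I_n -> R) (i : 'I_n) :
  periodic u L -> n%:R * h = L -> uniform_grid h x ->
  u (x (ordS i)) = u (x i + h) /\ u (x (ord_pred i)) = u (x i - h).
Proof.
move=> uL nh xh; split.
  have [->//|->] := uniform_grid_ordS i xh.
  by rewrite nh -uL subrK.
have := uniform_grid_ordS (ord_pred i) xh; rewrite ord_predK nh => -[|] ->.
  by rewrite addrK.
by rewrite -(uL (_ - h)); congr u; ring.
Qed.

(** * Accuracy of the averaging operators *)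

Lemma periodic_A_accuracy (R : realType) (L : R) (u : R -> R) :
  0 < L -> smooth u -> periodic u L ->
  exists C : R, \forall h \near 0^'+,
    forall (n : nat) (x : 'I_n -> R),
      n%:R * h = L -> uniform_grid h x ->
      forall i : 'I_n,
        `|periodic_A (fun j => u (x j)) i - u (x i)| <= C * h ^+ 2.
Proof.
move=> L0 su uL.
have [C C0 uC] := smooth_on_midpoint (smooth_smooth_on (- L) (L + L) su).
exists C; near=> h => n x nh xh i.
have h0 : 0 < h by near: h; exact: nbhs_right_gt.
(* The node [i] witnesses that [n] is positive, hence [h <= n * h = L]. *)
have hL : h <= L.
  rewrite -nh -[leLHS]mul1r ler_wpM2r ?(ltW h0)// ler1n.
  exact: leq_ltn_trans (ltn_ord i).
have [uS uP] := periodic_grid_neighbours i uL nh xh.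
rewrite /periodic_A uS uP.
have [z /andP[z0 zL]] := period_representative (x i) L0.
rewrite -(periodicz uL z (x i + h)) -(periodicz uL z (x i - h)).
rewrite -(periodicz uL z (x i)) !(addrAC (x i) _ (L *~ z)).
by apply: uC => //; lra.
Unshelve. all: by end_near. Qed.

Lemma sbp_A_accuracy (R : realType) (a b : R) (u : R -> R) :
  smooth_on a b u ->
  exists C : R, \forall h \near 0^'+,
    forall (N : nat) (x : 'I_N.+1 -> R),
      (0 < N)%N -> uniform_grid h x -> (forall i, x i \in `[a, b]) ->
      forall i : 'I_N.+1,
        (i != ord0 -> i != ord_max ->
           `|sbp_A (fun j => u (x j)) i - u (x i)| <= C * h ^+ 2) /\
        (i = ord0 \/ i = ord_max ->
           `|sbp_A (fun j => u (x j)) i - u (x i)| <= C * h).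
Proof.
move=> su; have [C1 C10 uC1] := smooth_on_lipschitz su.
have [C2 C20 uC2] := smooth_on_midpoint su.
(* The sum of the constants at the two orders serves for both. *)
exists (C1 + C2); near=> h => N x N0 xh xab i.
have h0 : 0 < h by near: h; exact: nbhs_right_gt.
have bnd (j k : 'I_N.+1) : k = j.+1 :> nat -> `|u (x j) - u (x k)| <= C1 * h.
  by move=> jk; rewrite -[in leRHS](gtr0_norm h0) -(xh _ _ jk) distrC uC1.
split=> [i0 iN|].
  have i1 : (0 < i)%N by rewrite lt0n.
  have i2 : (i < N)%N by rewrite ltn_neqAle iN -ltnS ltn_ord.
  have xS : x (inord i.+1) = x i + h.
    by rewrite -(xh i (inord i.+1)) ?inordK// addrC subrK.
  have xP : x (inord i.-1) = x i - h.
    have jN : (i.-1 < N.+1)%N.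
      by apply: leq_ltn_trans (ltn_ord i); exact: leq_pred.
    have Pi : i = (inord i.-1 : 'I_N.+1).+1 :> nat by rewrite inordK// (prednK i1).
    by rewrite -(xh _ _ Pi) subKr.
  rewrite /sbp_A (negbTE i0) (negbTE iN) xS xP.
  have := xab (inord i.-1); have := xab (inord i.+1).
  rewrite xS xP !in_itv/= => /andP[_ Sb] /andP[aP _].
  rewrite (le_trans (uC2 _ _ h0 aP Sb))// ler_wpM2r ?sqr_ge0//.
  by rewrite lerDr.
(* The mean of two values is at half their distance from each of them. *)
have half (p q : R) : `|p - q| <= C1 * h ->
    `|(p + q) / 2 - p| <= (C1 + C2) * h /\ `|(p + q) / 2 - q| <= (C1 + C2) * h.
  move=> pq; have C2h : 0 <= C2 * h by rewrite mulr_ge0// ltW.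
  have := normr_ge0 (p - q).
  have -> : (p + q) / 2 - p = - ((p - q) / 2) by field.
  have -> : (p + q) / 2 - q = (p - q) / 2 by field.
  by rewrite normrN normrM (ger0_norm (_ : 0 <= 2^-1))// ?invr_ge0//; split; lra.
case=> ->.
  have bnd01 : `|u (x ord0) - u (x (inord 1))| <= C1 * h.
    by apply: bnd; rewrite inordK.
  by rewrite /sbp_A eqxx (addrC (u (x (inord 1)))); case: (half _ _ bnd01).
have bndN : `|u (x (inord N.-1)) - u (x ord_max)| <= C1 * h.
  by apply: bnd; rewrite inordK/= (prednK N0).
rewrite /sbp_A ifN; last by rewrite -val_eqE/= -lt0n.
by rewrite eqxx (addrC (u (x ord_max))); case: (half _ _ bndN).
Unshelve. all: by end_near. Qed.

Unset Implicit Arguments.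

Theorem lemma3p1 (R : realType) :
  (* product rule, periodic case *)
  (forall (n : nat) (h : R) (u v : 'I_n -> R), 0 < h ->
     periodic_D h (u \* v) =1
       (periodic_A u \* periodic_D h v) \+ (periodic_D h u \* periodic_A v))
  /\
  (* product rule, non-periodic case *)
  (forall (N : nat) (h : R) (u v : 'I_N.+1 -> R), (0 < N)%N -> 0 < h ->
     sbp_D h (u \* v) =1
       (sbp_A u \* sbp_D h v) \+ (sbp_D h u \* sbp_A v))
  /\
  (* accuracy of A, periodic case: n nodes with spacing h on one period L *)
  (forall (L : R) (u : R -> R), 0 < L -> smooth u -> periodic u L ->
     exists C : R, \forall h \near 0^'+,
       forall (n : nat) (x : 'I_n -> R),
         n%:R * h = L -> uniform_grid h x ->
         forall i : 'I_n,
           `|periodic_A (fun j => u (x j)) i - u (x i)| <= C * h ^+ 2)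
  /\
  (* accuracy of A, non-periodic case: nodes x_0, ..., x_N in [a, b] *)
  (forall (a b : R) (u : R -> R), a < b -> smooth_on a b u ->
     exists C : R, \forall h \near 0^'+,
       forall (N : nat) (x : 'I_N.+1 -> R),
         (0 < N)%N -> uniform_grid h x -> (forall i, x i \in `[a, b]) ->
         forall i : 'I_N.+1,
           (i != ord0 -> i != ord_max ->
              `|sbp_A (fun j => u (x j)) i - u (x i)| <= C * h ^+ 2) /\
           (i = ord0 \/ i = ord_max ->
              `|sbp_A (fun j => u (x j)) i - u (x i)| <= C * h)).
Proof.
split; last split; last split.
- by move=> n h u v h0; apply: periodic_product_rule; rewrite gt_eqF.
- by move=> N h u v _ h0; apply: sbp_product_rule; rewrite gt_eqF.
- exact: periodic_A_accuracy.
- by move=> a b u _; exact: sbp_A_accuracy.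
Qed.
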